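(* Let $\mathsf{k}$ be a commutative ring, $A$ a countable set, and $\diamond$ a commutative associative $\mathsf{k}$-bilinear product on $\mathsf{k}A$. For $h\in A$ and an integer $l\ge1$, the following identity holds in $\mathsf{k}\langle A\rangle$: $$L_\diamond\bigl(\{h^{\diamond l}\}^{(1)}\bigr)=\sum_{\substack{a+b=l,\\ a\ge1,\ b\ge0}}(-1)^b\,L_\diamond\bigl(\{h\}^{(a,\{1\}^b)}\bigr).$$
   Context: $\mathsf{k}A$ is the free $\mathsf{k}$-module with basis $A$; $\mathsf{k}\langle A\rangle$ is the free associative $\mathsf{k}$-algebra on $A$ with basis the words. $h^{\diamond l}=h\diamond\cdots\diamond h$ ($l$ factors). $(a,\{1\}^b)$ is the hook partition $(a,1,\dots,1)$ with $b$ ones. For partitions $\mu\subseteq\lambda$, $D(\lambda/\mu)=\{(i,j):\mu_i<j\le\lambda_i\}$ ($i$ row, $j$ column). A Young tableau of shape $\mathrm{sh}(\mathbf h)=\lambda/\mu$ with entries in $A$ is any family $\mathbf h=(h_{i,j})_{(i,j)\in D(\lambda/\mu)}$. $\{h\}^{\lambda/\mu}$ denotes the tableau of shape $\lambda/\mu$ all of whose entries equal $h$. Tableaux may have entries in $\mathsf{k}A$, extended $\mathsf{k}$-linearly in each entry; in particular $\{h^{\diamond l}\}^{(1)}$ is the one-box tableau with entry $h^{\diamond l}\in\mathsf{k}A$. A skew shape is a horizontal strip if no column contains two boxes. A semi-standard decomposition of $\lambda/\mu$ is a tuple $(D_1,\dots,D_r)$, $D_t=D(\eta^{(t)}/\eta^{(t-1)})$,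 coming from a chain of partitions $\mu=\eta^{(0)}\subsetneq\cdots\subsetneq\eta^{(r)}=\lambda$ with every $\eta^{(t)}/\eta^{(t-1)}$ a horizontal strip; $\mathrm{SSD}(\lambda/\mu)$ is the set of these. The linearization map is the $\mathsf{k}$-linear map given on tableaux by $L_\diamond(\mathbf h)=\sum_{(D_1,\dots,D_r)\in\mathrm{SSD}(\mathrm{sh}(\mathbf h))}|\mathbf h_{D_1}|_\diamond\cdots|\mathbf h_{D_r}|_\diamond$ (concatenation product), where $|\mathbf h_D|_\diamond\in\mathsf{k}A$ is the $\diamond$-product of all $h_{i,j}$ with $(i,j)\in D$. *)

(* Defs.v *)
(* MathComp world, with finmap ({fset _}) and the monoid algebras {malg R[K]}
   of multinomials. *)
From HB Require Import structures.
From mathcomp Require Export all_boot all_order all_algebra.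
From mathcomp Require Export sesquilinear finmap monalg.

Set Implicit Arguments.
Unset Strict Implicit.
Unset Printing Implicit Defensive.

Import GRing.Theory.

Local Open Scope fset_scope.
Local Open Scope ring_scope.

(* Partitions are stored without trailing zeros, so that equality of partitions
   is equality of sequences; the i-th part (from i = 0) is nth 0 lam i. *)
Definition is_partition (s : seq nat) : bool := sorted geq s && (0%N \notin s).

Record partition : predArgType := Partition {
  parts :> seq nat;
  partsP : is_partition parts
}.

HB.instance Definition _ := [isSub for parts].
HB.instance Definition _ := [Choice of partition by <:].

Definition empty_partition : partition := @Partition [::] isT.

(* Junk value: the empty partition, when s is not a partition. *)
Definition to_partition (s : seq nat) : partition := insubd empty_partition s.

(* (a, 1, ..., 1) with b ones, for a >= 1. *)
Definition hook (a b : nat) : partition := to_partition (a :: nseq b 1%N).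

Lemma hookE (a b : nat) : (0 < a)%N -> hook a b = a :: nseq b 1%N :> seq nat.
Proof.
move=> a_gt0; rewrite /hook /to_partition insubdK // unfold_in /is_partition /=.
rewrite inE negb_or eq_sym -lt0n a_gt0 mem_nseq andbF andbT.
case: b => //= b; rewrite a_gt0 /=.
by elim: b => //= b ->.
Qed.

Definition included (mu lam : partition) : bool :=
  all (fun i => nth 0 mu i <= nth 0 lam i)%N (iota 0 (size mu)).

(* D(lam/mu), with rows and columns numbered from 0. *)
Definition diagram (lam mu : partition) : {fset nat * nat} :=
  [fset p in [seq (i, j) | i <- iota 0 (size lam),
                           j <- iota (nth 0 mu i) (nth 0 lam i - nth 0 mu i)]]%N.

Lemma includedP (mu lam : partition) :
  reflect (forall i, nth 0 mu i <= nth 0 lam i)%N (included mu lam).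
Proof.
apply: (iffP allP) => le_ml i; last by move=> _; apply: le_ml.
have [lt_i|ge_i] := ltnP i (size mu); first by apply: le_ml; rewrite mem_iota.
by rewrite nth_default.
Qed.

Lemma mem_diagram (lam mu : partition) (i j : nat) :
  ((i, j) \in diagram lam mu) = (nth 0 mu i <= j < nth 0 lam i)%N.
Proof.
rewrite /diagram inE /=; apply/allpairsPdep/idP => [[x [y [_ ]]]|/andP[le_j lt_j]].
  rewrite mem_iota => /andP[le_y lt_y] [-> ->]; rewrite le_y /=.
  have [/ltnW le_ml|] := ltnP (nth 0%N mu x) (nth 0%N lam x).
    by rewrite subnKC in lt_y.
  by move/eqP=> le_lm; move: lt_y; rewrite le_lm addn0 ltnNge le_y.
exists i, j; split=> //; rewrite mem_iota.
  rewrite /= add0n ltnNge; apply: contraTN lt_j => le_s.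
  by rewrite nth_default.
by rewrite le_j subnKC // ltnW // (leq_ltn_trans le_j).
Qed.

Record skew_shape : predArgType := SkewShape {
  outer_inner : partition * partition;
  outer_innerP : included outer_inner.2 outer_inner.1
}.

HB.instance Definition _ := [isSub for outer_inner].
HB.instance Definition _ := [Choice of skew_shape by <:].

Definition outer (sh : skew_shape) : partition := (outer_inner sh).1.
Definition inner (sh : skew_shape) : partition := (outer_inner sh).2.

Definition boxes (sh : skew_shape) : {fset nat * nat} :=
  diagram (outer sh) (inner sh).

Definition straight (lam : partition) : skew_shape :=
  @SkewShape (lam, empty_partition) isT.

Definition horizontal_strip (D : {fset nat * nat}) : bool :=
  [forall p : D, forall q : D, ((val p).2 == (val q).2) ==> (p == q)].

Definition ssd_step (mu eta : partition) : bool :=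
  [&& included mu eta, mu != eta & horizontal_strip (diagram eta mu)].

Fixpoint sub_rows (s : seq nat) : seq (seq nat) :=
  if s is a :: s' then
    [::] :: [seq b :: t | b <- iota 1 a, t <- sub_rows s']
  else [:: [::]].

Definition sub_partitions (lam : partition) : seq partition :=
  pmap insub (sub_rows lam).

Lemma mem_sub_rows (s t : seq nat) :
  (t \in sub_rows s) =
  (0%N \notin t) && all (fun i => nth 0 t i <= nth 0 s i)%N (iota 0 (size t)).
Proof.
elim: s t => [|a s IHs] [|b t] //=.
  by rewrite !inE leqn0 /=; case: b => //= b; rewrite ?andbF.
rewrite in_cons /= [LHS](_ : _ = (0 < b <= a)%N && (t \in sub_rows s)).
  rewrite IHs in_cons negb_or (iotaDl 1 0) all_map lt0n [_ == b]eq_sym.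
  by case: (b == _); case: (_ <= a)%N => //=; rewrite ?andbF.
apply/allpairsP/idP => [[[x y] /= [+ yP [-> ->]]]|/andP[bP tP]].
  by rewrite mem_iota add1n ltnS yP andbT.
by exists (b, t); rewrite mem_iota add1n ltnS.
Qed.

Lemma mem_sub_partitions (lam eta : partition) :
  (eta \in sub_partitions lam) = included eta lam.
Proof.
rewrite /sub_partitions mem_pmap_sub /= mem_sub_rows.
by case/andP: (partsP eta) => _ ->.
Qed.

Fixpoint bounded_chains (n : nat) (mu lam : partition) : seq (seq partition) :=
  (if mu == lam then [:: [::]] else [::]) ++
  (if n is n'.+1 then
     [seq eta :: c | eta <- [seq eta <- sub_partitions lam | ssd_step mu eta],
                     c <- bounded_chains n' eta lam]
   else [::]).

(* The chains mu = eta_0, eta_1, ..., eta_r = lam defining the semi-standard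
   decompositions, given as [:: eta_1; ...; eta_r] (see mem_ssd_chains); their
   length is at most the number of boxes since the inclusions are strict. *)
Definition ssd_chains (sh : skew_shape) : seq (seq partition) :=
  bounded_chains #|` boxes sh| (inner sh) (outer sh).

Lemma partition_eq (mu nu : partition) :
  (forall i, nth 0 mu i = nth 0 nu i)%N -> mu = nu.
Proof.
move=> eq_nth; have sz (x y : partition) : (forall i, nth 0 x i = nth 0 y i)%N -> (size x <= size y)%N.
  move=> E; rewrite leqNgt; apply/negP => lt_s.
  have /andP[_ /negP[]] := partsP x.
  by rewrite -(nth_default 0%N (leqnn (size y))) -E mem_nth.
apply/val_inj/(@eq_from_nth _ 0%N) => //=.
by apply/eqP; rewrite eqn_leq !sz.
Qed.

Lemma included_refl mu : included mu mu.
Proof. exact/includedP. Qed.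

Lemma included_trans : transitive included.
Proof.
move=> y x z /includedP xy /includedP yz; apply/includedP => i.
exact: leq_trans (xy i) (yz i).
Qed.

Lemma chain_included mu lam c :
  path ssd_step mu c -> last mu c = lam -> included mu lam.
Proof.
elim: c mu => [|eta c IH] mu /=; first by move=> _ ->; apply: included_refl.
by move=> /andP[/and3P[le_me _ _] /IH{}IH] /IH; apply: included_trans.
Qed.

Lemma card_diagram_lt mu eta lam : ssd_step mu eta -> included eta lam ->
  (#|` diagram lam eta| < #|` diagram lam mu|)%N.
Proof.
move=> /and3P[/includedP le_me ne_me _] /includedP le_el.
apply: fproper_ltn_card; rewrite fproperEneq; apply/andP; split; last first.
  apply/fsubsetP => -[i j]; rewrite !mem_diagram => /andP[le_j ->].
  by rewrite (leq_trans _ le_j).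
apply: contraNneq ne_me => eqD; apply/eqP/partition_eq => i.
apply/eqP; rewrite eqn_leq le_me /= leqNgt; apply/negP => lt_i.
have := mem_diagram lam mu i (nth 0%N mu i).
rewrite -eqD mem_diagram leqnn (leq_trans lt_i) //= andbT => le_i.
by move: lt_i; rewrite ltnNge le_i.
Qed.

Lemma mem_bounded_chains n mu lam c : (#|` diagram lam mu| <= n)%N ->
  (c \in bounded_chains n mu lam) = path ssd_step mu c && (last mu c == lam).
Proof.
elim: n mu c => [|n IHn] mu c /= le_n; rewrite mem_cat.
  rewrite in_nil orbF; case: c => [|eta c] /=.
    by case: eqP.
  apply/idP/idP; first by case: ifP.
  move=> /andP[/andP[st pc] /eqP lc].
  have := card_diagram_lt st (chain_included pc lc).
  by rewrite ltnNge (leq_trans le_n).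
case: c => [|eta c] /=.
  rewrite [X in _ || X](_ : _ = false) ?orbF; first by case: eqP.
  by apply/negbTE/allpairsPdep => -[? [? []]].
rewrite [X in X || _](_ : _ = false) /=; last by case: ifP.
apply/allpairsPdep/idP => [[x [y [+ + [-> ->]]]]|/andP[/andP[st pc] /eqP lc]].
  rewrite mem_filter mem_sub_partitions => /andP[st le_x].
  rewrite st /= -IHn //.
  by rewrite -ltnS (leq_trans _ le_n) ?card_diagram_lt.
have le_x := chain_included pc lc.
exists eta, c; rewrite mem_filter st mem_sub_partitions le_x; split=> //=.
rewrite IHn ?pc ?lc ?eqxx //.
by rewrite -ltnS (leq_trans _ le_n) ?card_diagram_lt.
Qed.

Lemma mem_ssd_chains (sh : skew_shape) (c : seq partition) :
  (c \in ssd_chains sh) =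
  path ssd_step (inner sh) c && (last (inner sh) c == outer sh).
Proof. exact: mem_bounded_chains. Qed.

Definition SSD (sh : skew_shape) : {fset seq {fset nat * nat}} :=
  [fset D in [seq pairmap (fun mu eta => diagram eta mu) (inner sh) c
             | c <- ssd_chains sh]].

Definition filling (B : choiceType) (sh : skew_shape) : choiceType :=
  {ffun boxes sh -> B}.

Definition tableau (B : choiceType) : choiceType :=
  {sh : skew_shape & filling B sh}.

Definition shape (B : choiceType) (h : tableau B) : skew_shape := tag h.

Definition const_tableau (B : choiceType) (sh : skew_shape) (x : B) : tableau B :=
  Tagged (filling B) ([ffun=> x] : filling B sh).

Section Linearization.

Variables (k : comNzRingType) (A : choiceType).

Local Notation kA := {malg k[A]}.
Local Notation words := {malg k[{fmonom A}]}.

Implicit Type op : kA -> kA -> kA.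

(* No unit is assumed: the value 0 on the empty sequence is never used. *)
Definition op_prod op (s : seq kA) : kA :=
  if s is x :: s' then \big[op/x]_(y <- s') y else 0.

Definition op_exp op (x : kA) (l : nat) : kA := op_prod op (nseq l x).

Definition entries_prod op (h : tableau A) (D : {fset nat * nat}) : kA :=
  op_prod op [seq << tagged h p >>
             | p <- enum [pred p : boxes (shape h) | val p \in D]].

(* The inclusion of kA into the free algebra: letters are words of length 1. *)
Definition letters (x : kA) : words := \sum_(a <- msupp x) x@_a *: << fmu a >>.

Definition linearization_tableau op (h : tableau A) : words :=
  \sum_(Ds <- SSD (shape h)) \prod_(D <- Ds) letters (entries_prod op h D).

Definition linearization op (T : {malg k[tableau A]}) : words :=
  \sum_(h <- msupp T) T@_h *: linearization_tableau op h.

(* A tableau with entries in kA, as a combination of tableaux with entries in A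
   by multilinear expansion; the product over boxes picks one basis element in
   the support of each entry. *)
Definition expand (H : tableau kA) : {malg k[tableau A]} :=
  let S : {fset A} := \big[fsetU/fset0]_(p : boxes (shape H)) msupp (tagged H p) in
  \sum_(g : {ffun boxes (shape H) -> S})
    (\prod_p (tagged H p)@_(val (g p))) *:
      << Tagged (filling A) ([ffun p => val (g p)] : filling A (shape H)) >>.

End Linearization.

Lemma linearizationU (k : comNzRingType) (A : choiceType) op (h : tableau A) :
  @linearization k A op << h >> = linearization_tableau op h.
Proof. by rewrite /linearization msuppU oner_eq0 big_seq_fset1 mcoeffUU scale1r. Qed.

Lemma linearizationE (k : comNzRingType) (A : choiceType) op
    (T : {malg k[tableau A]}) (d : {fset tableau A}) : msupp T `<=` d ->
  @linearization k A op T = \sum_(h <- d) T@_h *: linearization_tableau op h.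
Proof.
move=> le_d; rewrite /linearization; apply: big_fset_incl => // h _.
by move/mcoeff_outdom->; rewrite scale0r.
Qed.

Lemma linearization_is_linear (k : comNzRingType) (A : choiceType) op :
  linear (@linearization k A op).
Proof.
move=> a T U; pose d := msupp T `|` msupp U `|` msupp (a *: T + U).
have sT : msupp T `<=` d by rewrite /d -fsetUA fsubsetUl.
have sU : msupp U `<=` d by rewrite /d fsetUAC fsubsetUr.
have sTU : msupp (a *: T + U) `<=` d by rewrite /d fsubsetUr.
rewrite (linearizationE _ sT) (linearizationE _ sU) (linearizationE _ sTU).
rewrite scaler_sumr -big_split /=; apply: eq_bigr => h _.
by rewrite mcoeffD mcoeffZ scalerDl scalerA.
Qed.

(* Main.v *)
(* Let x_n be the letter h^{<>n}.  A chain of hooks from the empty partition to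
   (a, 1^b) amounts to a composition (n_1, ..., n_r) of a + b, together with the
   choice of b of the steps 2, ..., r: an unchosen step of size n adds n boxes to
   the arm, a chosen one adds n - 1 boxes to the arm and one to the leg.  So every
   word x_{n_1} ... x_{n_r} with r >= 2 cancels in the alternating sum, and x_l
   remains. *)
Require Import Defs.
From HB Require Import structures.
From mathcomp Require Import zify.

Set Implicit Arguments.
Unset Strict Implicit.
Unset Printing Implicit Defensive.

Import GRing.Theory.
Local Open Scope ring_scope.

(** * Horizontal strips and diagrams of partitions *)

Lemma leq_nth_partition (mu : partition) i j :
  (i <= j)%N -> (nth 0%N mu j <= nth 0%N mu i)%N.
Proof.
move=> le_ij; have [ge_j|lt_j] := leqP (size mu) j; first by rewrite nth_default.
have /andP[srt _] := partsP mu.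
by apply: (sorted_leq_nth (rev_trans leq_trans) leqnn) => //; apply: leq_ltn_trans lt_j.
Qed.

(** If part [i.+1] of [eta] exceeds part [i] of [mu], the column numbered by that part of [mu] has
    boxes in rows [i] and [i.+1]. Conversely, monotonicity of the parts carries the bound from
    consecutive rows to any two rows. *)
Lemma horizontal_stripP (mu eta : partition) : included mu eta ->
  reflect (forall i, nth 0 eta i.+1 <= nth 0 mu i)%N
          (horizontal_strip (diagram eta mu)).
Proof.
move=> /includedP le_me; apply: (iffP forallP) => [hs i|hs p].
  rewrite leqNgt; apply/negP => lt_i; set j := nth 0%N mu i in lt_i.
  have p1 : (i, j) \in diagram eta mu.
    by rewrite mem_diagram leqnn (leq_trans lt_i) // leq_nth_partition.
  have p2 : (i.+1, j) \in diagram eta mu.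
    by rewrite mem_diagram lt_i leq_nth_partition.
  move/forallP/(_ [` p2]%fset): (hs [` p1]%fset); rewrite eqxx /=.
  by move/eqP/(congr1 val) => /= [] /n_Sn.
apply/forallP => q; apply/implyP; case: p q => -[i j] /= ip [[i' j'] iq] /= /eqP ej.
apply/eqP/val_inj => /=; rewrite -{j'}ej in iq *; move: ip iq.
rewrite !mem_diagram => /andP[le1 lt1] /andP[le2 lt2].
congr pair; apply/eqP/negPn/negP.
have no u v : (u < v)%N -> (nth 0 mu u <= j)%N -> (j < nth 0 eta v)%N -> False.
  move=> lt_uv le_u; apply/negP; rewrite -leqNgt.
  by apply: leq_trans le_u; apply: leq_trans (hs u); apply: leq_nth_partition.
by rewrite neq_ltn => /orP[/no/(_ le1 lt2)|/no/(_ le2 lt1)].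
Qed.

(** If row [i] of [x] were longer than row [i] of [y], the first box after row [i] of [y] would lie
    in the diagram of [x] only; it is to the right of [mu] because [mu] lies inside [y]. *)
Lemma diagram_inj (mu eta eta' : partition) :
  included mu eta -> included mu eta' ->
  diagram eta mu = diagram eta' mu -> eta = eta'.
Proof.
have le x y : included mu y -> diagram x mu = diagram y mu ->
    forall i, (nth 0 x i <= nth 0 y i)%N.
  move=> /includedP le_my eD i; rewrite leqNgt; apply/negP => lt_i.
  have := mem_diagram x mu i (nth 0%N y i).
  by rewrite eD mem_diagram ltnn andbF le_my lt_i.
move=> le1 le2 eD; apply: partition_eq => i.
by apply/eqP; rewrite eqn_leq !le.
Qed.

Lemma size_included (mu lam : partition) : included mu lam -> (size mu <= size lam)%N.
Proof.
move=> /includedP le_ml; rewrite leqNgt; apply/negP => lt_s.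
have /andP[_ /negP[]] := partsP mu.
have := le_ml (size lam); rewrite [X in (_ <= X)%N]nth_default // leqn0 => /eqP <-.
exact: mem_nth.
Qed.

Lemma sumn_nth_iota (s : seq nat) n : (size s <= n)%N ->
  (\sum_(i <- iota 0 n) nth 0 s i)%N = sumn s.
Proof.
move=> le_s; rewrite -(subnKC le_s) iotaD big_cat /= [X in (_ + X)%N]big1_seq; last first.
  move=> i /=; rewrite mem_iota add0n => /andP[ge_i _]; exact: nth_default.
rewrite addn0 sumnE -[in RHS](mkseq_nth 0%N s) /mkseq big_map; exact: eq_bigr.
Qed.

Lemma card_diagram (mu lam : partition) : included mu lam ->
  #|` diagram lam mu| = (sumn lam - sumn mu)%N.
Proof.
move=> le_ml; have /includedP le_nth := le_ml.
rewrite /diagram card_fseq undup_id; last first.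
  apply: allpairs_uniq_dep => [|i _|[i j] [i' j'] _ _ /= [-> ->]] //; exact: iota_uniq.
rewrite size_allpairs_dep sumnE big_map.
rewrite -(sumn_nth_iota (size_included le_ml)) -(sumn_nth_iota (leqnn (size lam))).
rewrite -sumnB //; apply: eq_bigr => i _; exact: size_iota.
Qed.

(** * Chains are listed without repetition and determined by their diagrams *)

(** Allows sums over [SSD], a set of tuples of diagrams, to be taken over chains: from a common
    start, each diagram determines the next partition. *)
Lemma pairmap_diagram_inj mu c c' : path ssd_step mu c -> path ssd_step mu c' ->
  pairmap (fun mu eta => diagram eta mu) mu c =
  pairmap (fun mu eta => diagram eta mu) mu c' -> c = c'.
Proof.
elim: c mu c' => [|eta c IHc] mu [|eta' c'] //= /andP[st pc] /andP[st' pc'] [eD].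
have e : eta = eta'.
  by case/and3P: st => le _ _; case/and3P: st' => le' _ _; apply: diagram_inj eD.
by rewrite -e in pc' * => /(IHc _ _ pc pc') ->.
Qed.

Lemma sub_rows_uniq s : uniq (sub_rows s).
Proof.
elim: s => //= a s IHs; apply/andP; split.
  by apply/negP => /allpairsP[[x y] /= []].
apply: allpairs_uniq => //; first exact: iota_uniq.
by move=> [x y] [x' y'] _ _ /= [-> ->].
Qed.

Lemma sub_partitions_uniq lam : uniq (sub_partitions lam).
Proof. exact/pmap_sub_uniq/sub_rows_uniq. Qed.

Lemma bounded_chains_uniq n mu lam : uniq (bounded_chains n mu lam).
Proof.
elim: n mu => [|n IHn] mu /=; first by case: ifP.
rewrite cat_uniq; apply/and3P; split; first by case: ifP.
  apply/hasPn => c /allpairsPdep[eta [c' [_ _ ->]]].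
  by case: ifP.
apply: allpairs_uniq_dep => //; first exact/filter_uniq/sub_partitions_uniq.
by move=> [x y] [x' y'] _ _ /= [-> ->].
Qed.

(** * Weighted sums over chains *)

Section ChainSum.

Variables (R : nzRingType) (x : nat -> R).

(** A step adding [m] boxes has weight [x m]. With [x m] the letter of the [m]-th power of [h], and
    [n] the number of boxes, this is the linearization of a constant tableau. *)
Definition chain_sum (n : nat) (mu lam : partition) : R :=
  \sum_(c <- bounded_chains n mu lam)
    \prod_(D <- pairmap (fun mu eta => diagram eta mu) mu c) x #|` D|.

Lemma chain_sum0 mu lam : chain_sum 0 mu lam = (mu == lam)%:R.
Proof.
rewrite /chain_sum /= cats0; case: eqP => _; last by rewrite big_nil.
by rewrite big_seq1 big_nil.
Qed.

Lemma chain_sumS n mu lam :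
  chain_sum n.+1 mu lam = (mu == lam)%:R +
    \sum_(eta <- sub_partitions lam | ssd_step mu eta)
       x #|` diagram eta mu| * chain_sum n eta lam.
Proof.
rewrite /chain_sum /= big_cat; congr (_ + _).
  by case: eqP => _; rewrite ?big_nil // big_seq1 big_nil.
rewrite big_allpairs_dep big_filter; apply: eq_bigr => eta _.
by rewrite mulr_sumr; apply: eq_bigr => c _; rewrite big_cons.
Qed.

(** This half of [mem_bounded_chains] holds for every bound [n], even one below the number of
    boxes. *)
Lemma path_bounded_chains n mu lam c : c \in bounded_chains n mu lam ->
  path ssd_step mu c && (last mu c == lam).
Proof.
elim: n mu c => [|n IHn] mu c /=; rewrite mem_cat => /orP[].
- by case: ifP => // e; rewrite inE => /eqP ->.
- by [].
- by case: ifP => // e; rewrite inE => /eqP ->.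
case/allpairsPdep => eta [c' [+ /IHn pc ->]] /=.
by rewrite mem_filter => /andP[-> _].
Qed.

Lemma chain_sum_eq0 n mu lam : ~~ included mu lam -> chain_sum n mu lam = 0.
Proof.
move=> nle; rewrite /chain_sum big1_seq // => c /= /path_bounded_chains.
by case/andP=> pc /eqP lc; rewrite (chain_included pc lc) in nle.
Qed.

End ChainSum.

(** * Hooks and the steps between them *)

Lemma nth_hook a b i : (0 < a)%N ->
  nth 0%N (hook a b) i = if i is 0 then a else (i <= b)%N.
Proof. by move=> a_gt0; rewrite hookE //; case: i => //= i; rewrite nth_nseq; case: ltnP. Qed.

Lemma sumn_hook a b : (0 < a)%N -> sumn (hook a b) = (a + b)%N.
Proof. by move=> a_gt0; rewrite hookE //= sumn_nseq mul1n. Qed.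

Lemma hook_inj a b a' b' : (0 < a)%N -> (0 < a')%N ->
  (hook a b == hook a' b') = (a == a') && (b == b').
Proof.
move=> a_gt0 a'_gt0; apply/eqP/andP => [/(congr1 val)|[/eqP -> /eqP ->]] //=.
by rewrite !hookE // => -[-> /(congr1 size)]; rewrite !size_nseq => ->.
Qed.

Lemma included_hook a b a' b' : (0 < a)%N -> (0 < a')%N ->
  included (hook a b) (hook a' b') = (a <= a')%N && (b <= b')%N.
Proof.
move=> a_gt0 a'_gt0; apply/includedP/andP => [le|[le_a le_b] i].
  split; first by have := le 0%N; rewrite !nth_hook.
  have := le b; rewrite !nth_hook //; case: b {le} => //= b.
  by rewrite leqnn; case: ltnP.
rewrite !nth_hook //; case: i => // i.
by case: (ltnP i b) => // lt_i; rewrite (leq_trans lt_i).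
Qed.

Lemma included_empty lam : included empty_partition lam.
Proof. by []. Qed.

Lemma hook_neq_empty a b : (0 < a)%N -> hook a b != empty_partition.
Proof. by move=> a_gt0; apply/eqP => /(congr1 val) /=; rewrite hookE. Qed.

(** The leg lies in the first column, so a horizontal strip lengthens it by at most one; the arm can
    grow freely. For nested hooks, being distinct means having distinct sizes. *)
Lemma ssd_step_hook a b a' b' : (0 < a)%N -> (0 < a')%N ->
  ssd_step (hook a b) (hook a' b') =
  [&& (a <= a')%N, (b <= b' <= b.+1)%N & (a + b != a' + b')%N].
Proof.
move=> a_gt0 a'_gt0; rewrite /ssd_step included_hook // hook_inj //.
have [le_a|] //= := leqP a a'; have [le_b|] //= := leqP b b'.
have -> : (a == a') && (b == b') = (a + b == a' + b')%N.
  by apply/andP/eqP => [[/eqP -> /eqP ->] //|]; lia.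
rewrite andbC; congr (_ && _).
have inc : included (hook a b) (hook a' b') by rewrite included_hook // le_a.
apply/(horizontal_stripP inc)/idP => [hs|le_b' i].
  (* Row [b.+1] is the first one below the smaller hook, where its part is the default 0. *)
  rewrite leqNgt; apply/negP => lt_b; have := hs b.+1.
  by rewrite !nth_hook // lt_b ltnn.
rewrite !nth_hook //; case: i => [|i] /=; first by case: (_ < _)%N.
by case: (ltnP i.+1 b') => // /leq_trans/(_ le_b'); rewrite ltnS => ->.
Qed.

(** The first column is still empty, so the strip has a single row. Hence the first step of a chain
    offers no choice of leg. *)
Lemma ssd_step_empty_hook a b : (0 < a)%N ->
  ssd_step empty_partition (hook a b) = (b == 0%N).
Proof.
move=> a_gt0; rewrite /ssd_step included_empty eq_sym hook_neq_empty //=.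
apply/(horizontal_stripP (included_empty _))/eqP => [hs|-> i].
  have := hs 0%N; rewrite nth_hook //=; by case: b {hs}.
by rewrite nth_hook.
Qed.

(** The parts after the first are at most 1 by inclusion and nonzero by the encoding of partitions,
    so [eta] is determined by its head and its length. *)
Lemma included_hookP a b eta : (0 < a)%N -> included eta (hook a b) ->
  eta != empty_partition -> exists a' b', (0 < a')%N /\ eta = hook a' b'.
Proof.
move=> a_gt0 /includedP le ne; exists (head 0%N eta), (size eta).-1.
have /andP[_] := partsP eta.
case E: (parts eta) => [|c s] /=; first by case/eqP: ne; apply: val_inj.
rewrite inE negb_or eq_sym -lt0n => /andP[c_gt0 s_gt0]; split=> //.
apply: val_inj; rewrite /= E hookE //; congr (_ :: _).
apply/all_pred1P/allP => y ys; rewrite /= eqn_leq lt0n (memPn s_gt0) // andbT.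
have := le (index y s).+1; rewrite E /= nth_index // nth_hook // => /leq_trans.
by apply; apply: leq_b1.
Qed.

(** * The alternating sum over the hooks of size [l] *)

Section HookSum.

Variables (R : nzRingType) (x : nat -> R) (l : nat).

(** Indexing the first step by the size [s] and leg [j] of the hook reached gives a range
    independent of [b], so that it can be exchanged with the alternating sum over [b]. *)
Lemma chain_sum_hookS n mu b : (b < l)%N ->
  chain_sum x n.+1 mu (hook (l - b) b) = (mu == hook (l - b) b)%:R +
    \sum_(0 <= s < l.+1) \sum_(0 <= j < s | ssd_step mu (hook (s - j) j))
       x #|` diagram (hook (s - j) j) mu| * chain_sum x n (hook (s - j) j) (hook (l - b) b).
Proof.
move=> lt_b; rewrite chain_sumS; congr (_ + _).
set lam := hook _ _; have lb_gt0 : (0 < l - b)%N by rewrite subn_gt0.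
pose U := [seq hook (s - j) j | s <- iota 0 l.+1, j <- iota 0 s].
transitivity (\sum_(eta <- U | ssd_step mu eta && included eta lam)
    x #|` diagram eta mu| * chain_sum x n eta lam).
  rewrite -big_filter -[RHS]big_filter; apply: perm_big; apply: uniq_perm.
  - exact/filter_uniq/sub_partitions_uniq.
  - apply/filter_uniq/allpairs_uniq_dep => [|s _|[s j] [s' j']]; try exact: iota_uniq.
    move=> /allpairsPdep[s1 [j1 [_ + /= [-> ->]]]].
    rewrite mem_iota /= add0n => lt1 /allpairsPdep[s2 [j2 [_ + /= [-> ->]]]].
    rewrite mem_iota /= add0n => lt2 /eqP; rewrite hook_inj ?subn_gt0 //.
    case/andP=> /eqP + /eqP e; rewrite e in lt1 *.
    by move=> /(congr1 (addn^~ j2)); rewrite !subnK ?(ltnW lt1) ?(ltnW lt2) // => ->.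
  move=> eta; rewrite !mem_filter mem_sub_partitions -andbA; apply: andb_id2l => st.
  apply/idP/andP => [le|[]//]; split=> //.
  (* Steps are strict, so none ends at the empty partition. *)
  have ne : eta != empty_partition.
    case/and3P: st => le_me ne_me _; apply: contraNneq ne_me => e; apply/eqP.
    rewrite e in le_me *; apply: partition_eq => i; apply/eqP.
    by have /includedP/(_ i) := le_me; rewrite nth_nil leqn0.
  have [a' [b' [a'_gt0 e]]] := included_hookP lb_gt0 le ne.
  rewrite {}e included_hook // in le *; apply/allpairsPdep.
  exists (a' + b')%N, b'; rewrite !mem_iota addnK; split=> //; lia.
(* Hooks outside [lam] may be added to the sum: no chain leads from them to [lam]. *)
rewrite /U big_mkcond big_allpairs_dep /index_iota subn0; apply: eq_bigr => s _.
rewrite subn0 [RHS]big_mkcond; apply: eq_bigr => j _.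
case: (ssd_step _ _) => //=; case: ifP => // /negbT nle.
by rewrite chain_sum_eq0 ?mulr0.
Qed.

(** For [mu] empty and [n = l] this is the alternating sum of the theorem; a variable start permits
    induction on the first step. *)
Definition hook_sum n mu : R :=
  \sum_(0 <= b < l) (-1) ^+ b * chain_sum x n mu (hook (l - b) b).

Lemma hook_sumS n mu :
  hook_sum n.+1 mu = hook_sum 0 mu +
    \sum_(0 <= s < l.+1) \sum_(0 <= j < s | ssd_step mu (hook (s - j) j))
       x #|` diagram (hook (s - j) j) mu| * hook_sum n (hook (s - j) j).
Proof.
rewrite /hook_sum.
under eq_big_nat => b lt_b do rewrite chain_sum_hookS // mulrDr -(chain_sum0 x).
rewrite big_split /=; congr (_ + _).
under eq_bigr do rewrite mulr_sumr.
rewrite exchange_big /=; apply: eq_bigr => s _.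
under eq_bigr do rewrite mulr_sumr.
rewrite exchange_big /=; apply: eq_bigr => j _.
rewrite mulr_sumr; apply: eq_bigr => b _.
(* The weights need not commute with each other, but signs are central. *)
by rewrite !mulrA (commr_sign (x _)).
Qed.

Lemma hook_sum0 a b : (0 < a)%N ->
  hook_sum 0 (hook a b) = if (a + b == l)%N then (-1) ^+ b else 0.
Proof.
move=> a_gt0; rewrite /hook_sum.
have E i : (0 <= i < l)%N -> (-1) ^+ i * chain_sum x 0 (hook a b) (hook (l - i) i) =
   if (i == b) && (a + b == l)%N then (-1) ^+ i else 0.
  move=> /= lt_i; rewrite chain_sum0 hook_inj ?subn_gt0 //.
  have -> : (a == l - i)%N && (b == i) = (i == b) && (a + b == l)%N by lia.
  by case: ifP => _; rewrite ?mulr1 ?mulr0.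
rewrite (eq_big_nat _ _ E) -big_mkcondr /=.
case: eqP => [e|_].
  under eq_bigl do rewrite andbT.
  by rewrite big_nat1_eq; case: ifP => //; lia.
by rewrite big_pred0 // => i; rewrite andbF.
Qed.

(* From a hook of size less than [l], the induction hypothesis leaves only the two
   steps reaching size [l] at once, which add 0 or 1 box to the leg. *)
Lemma hook_sum_hook n a b : (0 < a)%N -> (l <= a + b + n)%N ->
  hook_sum n (hook a b) = if (a + b == l)%N then (-1) ^+ b else 0.
Proof.
elim: n a b => [|n IHn] a b a_gt0 le_l; first exact: hook_sum0.
rewrite hook_sumS hook_sum0 // -[RHS]addr0; congr (_ + _).
have S s : (s <= l)%N ->
  \sum_(0 <= j < s | ssd_step (hook a b) (hook (s - j) j))
     x #|` diagram (hook (s - j) j) (hook a b)| * hook_sum n (hook (s - j) j) =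
  \sum_(0 <= j < s | ssd_step (hook a b) (hook (s - j) j))
     x (s - (a + b))%N * if s == l then (-1) ^+ j else 0.
  move=> le_s; rewrite big_nat_cond [RHS]big_nat_cond.
  apply: eq_bigr => j /andP[/= lt_j st].
  have sj_gt0 : (0 < s - j)%N by rewrite subn_gt0.
  have inc : included (hook a b) (hook (s - j) j) by case/and3P: st.
  rewrite card_diagram // !sumn_hook // subnK ?(ltnW lt_j) // IHn //.
    by rewrite subnK ?(ltnW lt_j).
  (* The step is strict, so [s] exceeds [a + b] and the smaller bound [n] still suffices. *)
  move: st; rewrite ssd_step_hook //; lia.
under eq_big_nat => s /= le_s do rewrite S //.
rewrite big_nat_recr //= big_nat_cond big1 ?add0r; last first.
  move=> s /andP[/andP[_ lt_s] _]; rewrite ltn_eqF //.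
  by rewrite big1 // => j _; rewrite mulr0.
(* All steps to size [l] add equally many boxes, so their common weight factors out and only signs
   are summed. *)
rewrite eqxx -mulr_sumr big_nat_cond.
have [lt_ab|ge_ab] := ltnP (a + b) l; last first.
  rewrite big_pred0 ?mulr0 // => j; apply/negbTE/andP=> -[/= lt_j].
  rewrite ssd_step_hook ?subn_gt0 //; lia.
(* As [a + b < l], the legs [b] and [b.+1] are both reachable; their signs are opposite. *)
rewrite (eq_bigl (fun j => (0 <= j < l)%N && ((j == b) || (j == b.+1)))); last first.
  move=> j /=; apply: andb_id2l => lt_j; rewrite ssd_step_hook ?subn_gt0 //; lia.
rewrite -big_nat_cond (bigID (pred1 b)) /=.
rewrite (eq_bigl (pred1 b)) ?[X in _ + X](eq_bigl (pred1 b.+1)); last 2 first.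
- by move=> j /=; lia.
- by move=> j /=; lia.
rewrite !big_nat1_eq !ifT; [|lia..].
by rewrite exprS mulN1r subrr mulr0.
Qed.

(** The first step reaches a single row, and by [hook_sum_hook] only the row of length [l]
    contributes, with sign 1. *)
Lemma hook_sum_empty : (0 < l)%N -> hook_sum l empty_partition = x l.
Proof.
move=> l_gt0; rewrite -[X in hook_sum X _](prednK l_gt0) hook_sumS.
rewrite [hook_sum 0 _]big_nat big1 ?add0r; last first.
  move=> b /= lt_b; rewrite chain_sum0 eq_sym.
  by rewrite (negbTE (hook_neq_empty _ _)) ?subn_gt0 // mulr0.
have S s : \sum_(0 <= j < s | ssd_step empty_partition (hook (s - j) j))
     x #|` diagram (hook (s - j) j) empty_partition| * hook_sum l.-1 (hook (s - j) j) =
  if (0 < s)%N && (s == l)%N then x s else 0.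
  have E j : (0 <= j < s)%N && ssd_step empty_partition (hook (s - j) j) =
      (0 <= j < s)%N && (j == 0)%N.
    by apply: andb_id2l => lt_j; rewrite ssd_step_empty_hook ?subn_gt0.
  rewrite big_nat_cond (eq_bigl _ _ E) -big_nat_cond big_nat1_eq /=.
  have [s_gt0|] //= := ltnP 0 s; rewrite subn0.
  rewrite card_diagram ?included_empty // sumn_hook // subn0 hook_sum_hook //; last lia.
  by rewrite !addn0; case: eqP => _; rewrite ?mulr1 ?mulr0.
under eq_bigr do rewrite S.
rewrite big_nat_recr //= l_gt0 eqxx big_nat_cond big1 ?add0r // => s.
by rewrite andbT => /= lt_s; rewrite ltn_eqF // andbF.
Qed.

End HookSum.

(** * Linearization of constant tableaux *)

Lemma sub_boxes_chain mu c D : path ssd_step mu c ->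
  D \in pairmap (fun mu eta => diagram eta mu) mu c ->
  (D `<=` diagram (last mu c) mu)%fset.
Proof.
elim: c mu => //= eta c IHc mu /andP[st pc].
have /includedP le_el := chain_included pc erefl.
have /includedP le_me : included mu eta by case/and3P: st.
rewrite inE => /orP[/eqP ->|/(IHc _ pc)/fsubsetP sub].
  apply/fsubsetP => -[i j]; rewrite !mem_diagram => /andP[-> /=].
  by move/leq_trans; apply.
apply/fsubsetP => -[i j] /sub; rewrite !mem_diagram => /andP[le_j ->].
by rewrite (leq_trans _ le_j).
Qed.

Section ConstantTableau.

Variables (k : comNzRingType) (A : choiceType).
Variable op : {malg k[A]} -> {malg k[A]} -> {malg k[A]}.

(** Since [D] lies inside the shape, the product has exactly one factor for each box of [D]. *)
Lemma entries_prod_const (sh : skew_shape) (h : A) (D : {fset nat * nat}) :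
  (D `<=` boxes sh)%fset ->
  entries_prod op (const_tableau sh h) D = op_exp op << h >> #|` D|.
Proof.
move=> sub; rewrite /entries_prod /op_exp; congr op_prod.
have -> : #|` D| = size (enum [pred p : boxes sh | val p \in D]).
  rewrite -(size_map val); apply/perm_size/uniq_perm; first exact: fset_uniq.
    by rewrite (map_inj_uniq val_inj) enum_uniq.
  move=> p; apply/idP/mapP => [pD|[q + ->]]; last by rewrite mem_enum.
  by exists [` fsubsetP sub p pD]%fset; rewrite ?mem_enum.
by elim: (enum _) => //= p s ->; rewrite ffunE.
Qed.

Lemma linearization_const (sh : skew_shape) (h : A) :
  linearization_tableau op (const_tableau sh h) =
  chain_sum (fun n => letters (op_exp op << h >> n))
    #|` boxes sh| (inner sh) (outer sh).
Proof.
rewrite /linearization_tableau /chain_sum /=.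
rewrite -(big_map (pairmap (fun mu eta => diagram eta mu) (inner sh)) predT
  (fun Ds => \prod_(D <- Ds) letters (op_exp op << h >> #|` D|))).
rewrite -/(ssd_chains sh) (perm_big
  [seq pairmap (fun mu eta => diagram eta mu) (inner sh) c | c <- ssd_chains sh]) /=.
  apply: eq_big_seq => Ds /mapP[c].
  rewrite mem_ssd_chains => /andP[pc /eqP lc] ->.
  apply: eq_big_seq => D /(sub_boxes_chain pc); rewrite lc => sub.
  by rewrite entries_prod_const.
apply: uniq_perm; first exact: fset_uniq.
  rewrite map_inj_in_uniq ?bounded_chains_uniq // => c c'.
  rewrite !mem_ssd_chains => /andP[pc _] /andP[pc' _]; exact: pairmap_diagram_inj.
by move=> Ds; rewrite /SSD inE.
Qed.

Lemma sum_linearization_hook (h : A) (l : nat) : (0 < l)%N ->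
  \sum_(1 <= a < l.+1) \sum_(0 <= b < l.+1 | (a + b == l)%N)
     (-1) ^+ b *: linearization op << const_tableau (straight (hook a b)) h >>
  = letters (op_exp op << h >> l).
Proof.
move=> l_gt0.
rewrite -(hook_sum_empty (fun n => letters (op_exp op << h >> n)) l_gt0).
(* Reversing the leg sum and shifting the arm range pairs arm [a.+1] with leg [l - a.+1]. *)
rewrite /hook_sum [RHS]big_nat_rev big_add1 /=; apply: eq_big_nat => a /= lt_a.
rewrite add0n.
have E b : (0 <= b < l.+1)%N && (a.+1 + b == l)%N = (0 <= b < l.+1)%N && (b == l - a.+1)%N.
  by lia.
rewrite big_nat_cond (eq_bigl _ _ E) -big_nat_cond big_nat1_eq ltnS leq_subr.
rewrite subKn // linearizationU linearization_const.
rewrite /boxes card_diagram ?included_empty // sumn_hook // subn0 subnKC //.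
(* The sign is a scalar of [k] on one side and an element of the free algebra on the other. *)
by rewrite -signr_odd scaler_sign -mulr_sign signr_odd.
Qed.

End ConstantTableau.

(** * The one-box tableau with entry in the free module *)

Lemma lettersU (k : comNzRingType) (A : choiceType) (a : A) :
  letters (<< a >> : {malg k[A]}) = << fmu a >>.
Proof. by rewrite /letters msuppU oner_eq0 big_seq_fset1 mcoeffUU scale1r. Qed.

Lemma lettersE (k : comNzRingType) (A : choiceType) (x : {malg k[A]}) (d : {fset A}) :
  (msupp x `<=` d)%fset -> letters x = \sum_(a <- d) x@_a *: << fmu a >>.
Proof.
move=> le_d; rewrite /letters; apply: big_fset_incl => // a _.
by move/mcoeff_outdom->; rewrite scale0r.
Qed.

HB.instance Definition _ (k : comNzRingType) (A : choiceType)
    (op : {malg k[A]} -> {malg k[A]} -> {malg k[A]}) :=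
  GRing.isLinear.Build _ _ _ _ (@linearization k A op) (linearization_is_linear op).

Lemma linearization_one_box (k : comNzRingType) (A : choiceType)
    (op : {malg k[A]} -> {malg k[A]} -> {malg k[A]}) (y : {malg k[A]}) :
  linearization op (expand (const_tableau (straight (hook 1 0)) y)) = letters y.
Proof.
(* For an entry in [A], this is the case [l = 1] of [sum_linearization_hook]. *)
have boxE (a : A) : linearization op << const_tableau (straight (hook 1 0)) a >> = << fmu a >>.
  have := sum_linearization_hook op a (ltn0Sn 0).
  rewrite /op_exp /= big_nil lettersU big_nat1 big_mkcond !big_nat_recr /= ?big_geq //.
  by rewrite addr0 add0r scale1r.
have p0P : (0, 0)%N \in boxes (straight (hook 1 0)) by rewrite mem_diagram nth_hook.
pose p0 := [` p0P]%fset.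
have p0E p : p = p0.
  apply: val_inj; case: p => -[i j] /=.
  rewrite mem_diagram nth_nil nth_hook //; case: i => [|i]; last by rewrite ltn0.
  by case: j.
rewrite /expand /=; set S : {fset A} := \big[fsetU/fset0]_p _.
have sub : (msupp y `<=` S)%fset.
  rewrite /S (bigD1 p0) //= ffunE; exact: fsubsetUl.
rewrite (lettersE sub) big_seq_fsetE /=.
(* With a single box, the choice functions of [expand] are the constants, indexed by [S]. *)
rewrite linear_sum (reindex (fun s : S => [ffun=> s] : {ffun boxes (straight (hook 1 0)) -> S})) /=.
  apply: eq_bigr => s _; rewrite linearZ /= (bigD1 p0) //= big_pred0 ?mulr1 => [|p]; last first.
    by rewrite (p0E p) eqxx.
  rewrite !ffunE -boxE; congr (_ *: linearization op << Tagged _ _ >>).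
  by apply/ffunP => p; rewrite !ffunE.
exists (fun g : {ffun _ -> S} => g p0) => g _; first by rewrite ffunE.
by apply/ffunP => p; rewrite ffunE (p0E p).
Qed.


Theorem theorem2 (k : comNzRingType) (A : countType)
  (dia : {bilinear {malg k[A]} -> {malg k[A]} -> {malg k[A]}})
  (diaC : commutative dia) (diaA : associative dia)
  (h : A) (l : nat) (hl : (1 <= l)%N) :
  linearization dia
    (expand (const_tableau (straight (to_partition [:: 1%N]))
                           (op_exp dia << h >> l)))
  = \sum_(1 <= a < l.+1) \sum_(0 <= b < l.+1 | (a + b == l)%N)
      (-1) ^+ b *: linearization dia << const_tableau (straight (hook a b)) h >>.
Proof.
by rewrite sum_linearization_hook // -/(hook 1 0) linearization_one_box.
Qed.
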